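(* Consider the alignment problem with $m\ge2$ ($m$ fixed) Erdős–Rényi graphs with parameters $p,s$ possibly depending on $n$, as defined in the context. If $nps^2=O(1)$ as $n\to\infty$, then almost-exact alignment is impossible.
   Context: Let $\mathcal{E}_n=\binom{[n]}{2}$ and $\mathfrak{S}_n$ the set of permutations of $[n]$, acting on $\mathcal{E}_n$ by $\tau(\{i,j\})=\{\tau(i),\tau(j)\}$. An alignment is an $m$-tuple $\pi=(\pi_1,\dots,\pi_m)$ of permutations with $\pi_1=\mathrm{Id}$. The observation $X=(X^1,\dots,X^m)$ consists of $m$ symmetric $\{0,1\}$-valued $n\times n$ matrices with zero diagonal. Under $\mathsf{P}$ there is a uniformly distributed random alignment $\pi^\star$ and, conditioned on $\pi^\star$, $X^k_{\pi^\star_k(e)}=X^0_e\,\xi^k_e$ for $e\in\mathcal{E}_n$, $1\le k\le m$, where $X^0_e\sim\mathrm{Bern}(p)$ and $\xi^k_e\sim\mathrm{Bern}(s)$ are all mutually independent. Overlap: $\mathrm{ov}(\pi,\pi')=\frac1n|\{i\in[n]:\pi_k(i)=\pi'_k(i)\text{ for all }2\le k\le m\}|$. An estimator $\hat\pi=\hat\pi(X)$ achieves almost-exact alignment if $\mathsf{P}(\mathrm{ov}(\pi^\star,\hat\pi)\ge1-\epsilon)=1-o(1)$ for all $\epsilon>0$; almost-exact alignment is impossible if no estimator achieves it. *)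

(* Defs.v *)
From HB Require Import structures.
From mathcomp Require Import all_boot all_order all_algebra all_fingroup.
From mathcomp Require Import all_classical all_reals all_analysis.
Set Implicit Arguments.
Unset Strict Implicit.
Unset Printing Implicit Defensive.
Import Order.TTheory GRing.Theory Num.Theory.
Import numFieldNormedType.Exports.
Local Open Scope ring_scope.

Definition edge (n : nat) := {e : {set 'I_n} | #|e| == 2%N}.

Lemma edge_actP n (tau : 'S_n) (e : edge n) : #|tau @: val e| == 2%N.
Proof. by rewrite card_imset ?(valP e)//; exact: perm_inj. Qed.

Definition edge_act n (tau : 'S_n) (e : edge n) : edge n :=
  exist _ (tau @: val e) (edge_actP tau e).

(* Graphs are indexed by 'I_m, so the index 0 plays the role of the first
   graph, whose permutation is the identity. *)
Definition alignment (m n : nat) :=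
  {tau : {ffun 'I_m -> 'S_n} |
    [forall k : 'I_m, (val k == 0%N) ==> (tau k == 1%g)]}.

Definition adjmx (n : nat) :=
  {A : 'M[bool]_n | (A^T == A) && [forall i, ~~ A i i]}.

Definition observation (m n : nat) := {ffun 'I_m -> adjmx n}.

(* An outcome is a triple (pi*, X^0, xi). *)
Definition outcome (m n : nat) : Type :=
  (alignment m n * {ffun edge n -> bool} *
   {ffun 'I_m -> {ffun edge n -> bool}})%type.

Definition star m n (w : outcome m n) : alignment m n := w.1.1.
Definition parent m n (w : outcome m n) : {ffun edge n -> bool} := w.1.2.
Definition sampling m n (w : outcome m n) :
  {ffun 'I_m -> {ffun edge n -> bool}} := w.2.

(* [insub [set i; j]] is [None] exactly on the diagonal. *)
Definition mx_of_edges n (f : edge n -> bool) : 'M[bool]_n :=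
  \matrix_(i, j) (if insub [set i; j] is Some e then f e else false).

Lemma mx_of_edgesP n (f : edge n -> bool) :
  ((mx_of_edges f)^T == mx_of_edges f) && [forall i, ~~ mx_of_edges f i i].
Proof.
apply/andP; split.
  by apply/eqP/matrixP => i j; rewrite !mxE finset.setUC.
by apply/forallP => i; rewrite mxE insubF// finset.setUid cards1.
Qed.

Definition adj_of_edges n (f : edge n -> bool) : adjmx n :=
  exist _ (mx_of_edges f) (mx_of_edgesP f).

Definition obs m n (w : outcome m n) : observation m n :=
  [ffun k => adj_of_edges (fun e =>
     let e0 := edge_act (val (star w) k)^-1%g e in
     parent w e0 && sampling w k e0)].

Lemma obsE m n (w : outcome m n) (k : 'I_m) (e : edge n) (i j : 'I_n) :
  val (edge_act (val (star w) k) e) = [set i; j] ->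
  val (obs w k) i j = parent w e && sampling w k e.
Proof.
move=> ij; rewrite ffunE mxE -ij valK.
suff -> : edge_act (val (star w) k)^-1%g (edge_act (val (star w) k) e) = e by [].
apply: val_inj => /=; rewrite -imset_comp -[RHS]imset_id.
by apply: eq_imset => x /=; rewrite permK.
Qed.

Section law.
Variables (R : realType) (m n : nat) (p s : R).

Definition mass (w : outcome m n) : R :=
  #|{: alignment m n}|%:R^-1 *
  (\prod_(e : edge n) bernoulli_pmf p (parent w e)) *
  (\prod_(k < m) \prod_(e : edge n) bernoulli_pmf s (sampling w k e)).

Definition Pr (A : pred (outcome m n)) : R := \sum_(w | A w) mass w.

Lemma mass_ge0 w : 0 <= p <= 1 -> 0 <= s <= 1 -> 0 <= mass w.
Proof.
move=> p01 s01; rewrite /mass !mulr_ge0 ?invr_ge0//.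
  by apply: prodr_ge0 => e _; exact: bernoulli_pmf_ge0.
by apply: prodr_ge0 => k _; apply: prodr_ge0 => e _; exact: bernoulli_pmf_ge0.
Qed.

Lemma Pr_setT : Pr predT = 1.
Proof.
have bern1 (q : R) : \sum_(b : bool) bernoulli_pmf q b = 1.
  by rewrite big_bool /= addrC subrK.
have bernI (I : finType) (q : R) :
    \sum_(f : {ffun I -> bool}) \prod_i bernoulli_pmf q (f i) = 1.
  by rewrite -(bigA_distr_bigA (fun _ : I => bernoulli_pmf q)) big1.
have xi1 : \sum_(x : {ffun 'I_m -> {ffun edge n -> bool}})
    \prod_(k < m) \prod_e bernoulli_pmf s (x k e) = 1.
  rewrite -(bigA_distr_bigA (fun (_ : 'I_m) (f : {ffun edge n -> bool}) =>
    \prod_e bernoulli_pmf s (f e))).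
  by rewrite big1.
have al0 : (0 < #|{: alignment m n}|)%N.
  suff h : [forall k : 'I_m, (val k == 0%N) ==> ([ffun=> 1%g] k == 1%g :> 'S_n)].
    by apply/card_gt0P; exists (exist _ [ffun=> 1%g] h).
  by apply/forallP => k; rewrite ffunE eqxx implybT.
rewrite /Pr -(pair_bigA _ (fun a x => mass (a, x))) /=.
under eq_bigr do rewrite /mass /parent /sampling /= -mulr_sumr xi1 mulr1.
rewrite -(pair_bigA _ (fun (a : alignment m n) (f : {ffun edge n -> bool}) =>
  #|{: alignment m n}|%:R^-1 * \prod_e bernoulli_pmf p (f e))) /=.
under eq_bigr do rewrite -mulr_sumr bernI mulr1.
by rewrite sumr_const -[LHS]mulr_natl mulfV// pnatr_eq0 -lt0n.
Qed.

End law.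

Definition ov (R : realType) m n (pi pi' : alignment m n) : R :=
  #|[set i : 'I_n |
      [forall k : 'I_m, (0 < k)%N ==> (val pi k i == val pi' k i)]]|%:R / n%:R.

Definition estimator (m n : nat) := observation m n -> alignment m n.

Definition almost_exact (R : realType) (m : nat) (p s : nat -> R)
    (pihat : forall n, estimator m n) : Prop :=
  forall eps : R, 0 < eps ->
    (Pr (p n) (s n) (fun w => 1 - eps <= ov R (star w) (pihat n (obs w)))
       @[n --> \oo] --> (1 : R))%classic.

(* Main.v *)
Require Import Defs.
From mathcomp Require Import all_boot all_order all_algebra all_fingroup.
From mathcomp Require Import all_classical all_reals all_analysis.
From mathcomp Require Import lra.
Import Order.TTheory GRing.Theory Num.Theory.
Import numFieldNormedType.Exports.
Local Open Scope classical_set_scope.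
Local Open Scope ring_scope.

(** The obstruction is local: two vertices i and j of one graph k <> 0 can be
    exchanged in pi*_k without the observation noticing, as soon as no edge at
    i or j survives both in graph k and in another graph.

    Precisely, [swap] is an involution of the probability space that replaces
    pi*_k by pi*_k o (i j) and rearranges the random bits attached to each pair
    of edges e and (i j)e.  It preserves the probability of every outcome
    ([swap_mass]), and it preserves the observation X on the event that i and j
    are isolated in the above sense ([obs_swap]).  An estimator sees only X, so
    on that event it errs at i either on the outcome or on its image; hence
    P(i and j isolated) <= 2 P(error at i) ([isolated_mass_le]).

    At most 2n edges meet {i, j}, they are independent, and each is bad with
    probability at most q = m p s^2 (a union bound over the other graphs).  So
    P(i and j isolated) >= (1 - q)^(2n) ([isolated_mass_ge]), and n p s^2 = O(1)
    keeps this above a constant c > 0 ([expR_le_pow]).  Each vertex is therefore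
    misplaced with probability at least c/2, the expected number of misplaced
    vertices is at least nc/2, and the overlap cannot exceed 1 - c/4 with
    probability tending to 1 ([expected_wrong_le]). *)

(** * The bits attached to one edge *)

(** An edge e of the parent graph carries the bit X^0_e and the sampling bits
    (xi^k_e)_k.  Grouping the bits by edge makes the law a product
    over edges. *)
Definition column (m : nat) : Type := (bool * {ffun 'I_m -> bool})%type.

Definition seen {m} (k : 'I_m) (x : column m) : bool := x.1 && x.2 k.

Definition unshared {m} (k : 'I_m) (x : column m) : bool :=
  ~~ seen k x || [forall l : 'I_m, (l != k) ==> ~~ seen l x].

(** The new content of a column [x] when it trades places with [y] in graph [k]
    only: graph [k] must now show at [x] what it used to show at [y], the other
    graphs must show the same as before, and no probability may be lost.  With
    equal parent bits it suffices to trade the sampling bits of graph [k].  With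
    different parent bits, at most one column is seen in graph [k]: if none is,
    nothing has to change; if one is, the two columns are traded entirely, which
    the other graphs do not notice when they see neither of them. *)
Definition exchange {m} (k : 'I_m) (x y : column m) : column m :=
  if x.1 == y.1 then (x.1, [ffun l => if l == k then y.2 l else x.2 l])
  else if seen k x == seen k y then x else y.

Lemma exchange_id {m} (k : 'I_m) (x : column m) : exchange k x x = x.
Proof.
case: x => b f; rewrite /exchange eqxx /=; congr pair.
by apply/ffunP => l; rewrite ffunE; case: ifP.
Qed.

(** Equality of the parent bits and equality of the bits seen in graph [k] are
    both kept by the exchange, so the second exchange takes the same branch. *)
Lemma exchangeK {m} (k : 'I_m) (x y : column m) :
  exchange k (exchange k x y) (exchange k y x) = x.
Proof.
rewrite /exchange (eq_sym y.1) (eq_sym (seen k y)).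
case: (eqVneq x.1 y.1) => [xy|xy] /=.
  rewrite xy eqxx; case: x xy => b f /= ->; congr pair.
  by apply/ffunP => l; rewrite !ffunE; case: ifP => // ->.
case: (eqVneq (seen k x) (seen k y)) => sxy.
  by rewrite (negbTE xy) sxy eqxx.
by rewrite eq_sym (negbTE xy) eq_sym (negbTE sxy).
Qed.

Lemma seen_exchange {m} (k : 'I_m) (x y : column m) :
  seen k (exchange k x y) = seen k y.
Proof.
rewrite /exchange; case: eqP => [xy|_].
  by rewrite /seen /= ffunE eqxx xy.
by case: eqP.
Qed.

(** Only the complete trade could be noticed by graph [l].  There the column
    with parent bit 0 is seen nowhere, and the other one is seen in graph [k],
    hence, being unshared, not in graph [l]. *)
Lemma seen_exchange_other {m} (k l : 'I_m) (x y : column m) :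
  unshared k x -> unshared k y -> l != k ->
  seen l (exchange k x y) = seen l x.
Proof.
move=> ux uy lk; rewrite /exchange; case: eqP => [xy|xy].
  by rewrite /seen /= ffunE (negbTE lk).
case: eqP => // sxy.
have {}ux : seen k x -> ~~ seen l x.
  by move=> sx; move: ux; rewrite /unshared sx => /forallP/(_ l)/implyP; apply.
have {}uy : seen k y -> ~~ seen l y.
  by move=> sy; move: uy; rewrite /unshared sy => /forallP/(_ l)/implyP; apply.
by move: xy sxy ux uy; rewrite /seen; case: (x.1) (y.1) => -[] //= _ h ux uy;
  [apply/esym/negbTE/ux; case: (x.2 k) h | apply/negbTE/uy; case: (y.2 k) h].
Qed.

Definition column_mass {R : realType} {m} (p s : R) (x : column m) : R :=
  bernoulli_pmf p x.1 * \prod_(k < m) bernoulli_pmf s (x.2 k).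

Lemma column_mass_ge0 {R : realType} {m} (p s : R) (x : column m) :
  0 <= p <= 1 -> 0 <= s <= 1 -> 0 <= column_mass p s x.
Proof.
move=> p01 s01; apply: mulr_ge0; first exact: bernoulli_pmf_ge0.
by apply: prodr_ge0 => k _; exact: bernoulli_pmf_ge0.
Qed.

Lemma exchange_mass {R : realType} {m} (p s : R) (k : 'I_m) (x y : column m) :
  column_mass p s (exchange k x y) * column_mass p s (exchange k y x) =
  column_mass p s x * column_mass p s y.
Proof.
rewrite /exchange (eq_sym y.1) (eq_sym (seen k y)).
case: eqP => [xy|_]; last by case: eqP => // _; rewrite mulrC.
rewrite /column_mass /= mulrACA [RHS]mulrACA; congr (_ * _).
rewrite -!big_split; apply: eq_bigr => l _ /=; rewrite !ffunE.
by case: ifP => // _; rewrite mulrC.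
Qed.

Lemma sum_bernoulli {R : realType} (q : R) :
  \sum_(b : bool) bernoulli_pmf q b = 1.
Proof. by rewrite big_bool /= addrC subrK. Qed.

Lemma sum_column_mass {R : realType} {m} (p s : R) :
  \sum_(x : column m) column_mass p s x = 1.
Proof.
rewrite -(pair_bigA _ (fun b f => column_mass p s (b, f))) /=.
under eq_bigr do rewrite -mulr_sumr
  -(bigA_distr_bigA (fun _ : 'I_m => bernoulli_pmf s)).
rewrite -mulr_suml sum_bernoulli mul1r big1// => k _; exact: sum_bernoulli.
Qed.

(** The event fixes three independent bits; [F] is the mass of one sampling bit
    restricted to it. *)
Lemma shared_mass {R : realType} {m} (p s : R) (k l : 'I_m) : l != k ->
  \sum_(x : column m | seen k x && seen l x) column_mass p s x = p * s ^+ 2.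
Proof.
move=> lk.
pose F (i : 'I_m) (b : bool) : R :=
  if (i == k) || (i == l) then if b then s else 0 else bernoulli_pmf s b.
rewrite big_mkcond -(pair_bigA _ (fun b f => if seen k (b, f) && seen l (b, f)
  then column_mass p s (b, f) else 0)) big_bool /= [X in _ + X]big1_eq addr0.
transitivity (p * \sum_(f : {ffun 'I_m -> bool}) \prod_i F i (f i)).
  rewrite mulr_sumr; apply: eq_bigr => f _; rewrite /seen /=.
  case: ifPn => [/andP[fk fl]|].
    congr (_ * _); apply: eq_bigr => i _; rewrite /F.
    by case: ifP => // /orP[/eqP->|/eqP->]; rewrite ?fk ?fl.
  rewrite negb_and => /orP[fk|fk].
    by rewrite (bigD1 k)//= /F eqxx (negbTE fk) mul0r mulr0.
  by rewrite (bigD1 l)//= /F eqxx orbT (negbTE fk) mul0r mulr0.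
rewrite -bigA_distr_bigA (bigD1 k)//= (bigD1 l)//=.
rewrite [X in p * (_ * (_ * X))]big1 ?mulr1.
  by rewrite !big_bool /F !eqxx orbT /= !addr0 expr2.
by move=> i /andP[ik il]; rewrite /F (negbTE ik) (negbTE il) sum_bernoulli.
Qed.

(** Union bound over the graphs that may share the column with graph [k]. *)
Lemma unshared_mass_ge {R : realType} {m} (p s : R) (k : 'I_m) :
  0 <= p <= 1 -> 0 <= s <= 1 ->
  1 - m%:R * (p * s ^+ 2) <= \sum_(x | unshared k x) column_mass p s x.
Proof.
move=> p01 s01; rewrite lerBlDr -[leLHS](@sum_column_mass R m p s).
rewrite (bigID (unshared k)) lerD2l /=.
have ps0 : 0 <= p * s ^+ 2 by case/andP: p01 => *; rewrite mulr_ge0 ?sqr_ge0.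
have <- : \sum_(l < m) p * s ^+ 2 = m%:R * (p * s ^+ 2) :> R.
  by rewrite sumr_const card_ord mulr_natl.
apply: (@le_trans _ _ (\sum_(l < m | l != k)
  \sum_(x : column m | seen k x && seen l x) column_mass p s x)).
  under [leRHS]eq_bigr do rewrite big_mkcond.
  rewrite exchange_big /= big_mkcond; apply: ler_sum => x _.
  have mx := @column_mass_ge0 _ _ _ _ x p01 s01.
  case: ifPn => [|_]; last by apply: sumr_ge0 => l _; case: ifP.
  rewrite /unshared negb_or negbK => /andP[-> /forallPn[l]].
  rewrite negb_imply negbK => /andP[lk sl].
  rewrite (bigD1 l)//= sl lerDl; apply: sumr_ge0 => i _; by case: ifP.
rewrite (eq_bigr (fun=> p * s ^+ 2)) => [|l lk]; last exact: shared_mass.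
by rewrite big_mkcond; apply: ler_sum => l _; case: ifP.
Qed.

(** * The probability space, edge by edge *)

Definition config (m n : nat) : Type :=
  (alignment m n * {ffun edge n -> column m})%type.

Definition outcome_of {m n} (x : config m n) : outcome m n :=
  (x.1, [ffun e => (x.2 e).1], [ffun k => [ffun e => (x.2 e).2 k]]).

Lemma outcome_of_bij m n : bijective (@outcome_of m n).
Proof.
exists (fun w : outcome m n =>
  (star w, [ffun e => (parent w e, [ffun k => sampling w k e])])).
  move=> [a c]; rewrite /outcome_of /star /parent /sampling /=; congr pair.
  apply/ffunP => e; rewrite !ffunE [RHS]surjective_pairing; congr pair.
  by apply/ffunP => k; rewrite !ffunE.
move=> [[a f] xi]; rewrite /outcome_of /star /parent /sampling /=.
congr pair; first by congr pair; apply/ffunP => e; rewrite !ffunE.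
by apply/ffunP => k; rewrite ffunE; apply/ffunP => e; rewrite !ffunE.
Qed.

Definition config_mass {R : realType} {m n} (p s : R) (x : config m n) : R :=
  #|{: alignment m n}|%:R^-1 * \prod_(e : edge n) column_mass p s (x.2 e).

Lemma config_mass_ge0 {R : realType} {m n} (p s : R) (x : config m n) :
  0 <= p <= 1 -> 0 <= s <= 1 -> 0 <= config_mass p s x.
Proof.
move=> p01 s01; rewrite mulr_ge0 ?invr_ge0//.
by apply: prodr_ge0 => e _; exact: column_mass_ge0.
Qed.

Lemma mass_outcome_of {R : realType} {m n} (p s : R) (x : config m n) :
  mass p s (outcome_of x) = config_mass p s x.
Proof.
rewrite /mass /config_mass -mulrA; congr (_ * _).
rewrite exchange_big -big_split; apply: eq_bigr => e _ /=.
rewrite /column_mass /parent /sampling /= ffunE; congr (_ * _).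
by apply: eq_bigr => k _; rewrite !ffunE.
Qed.

Lemma Pr_config {R : realType} {m n} (p s : R) (A : pred (outcome m n)) :
  Pr p s A = \sum_(x : config m n | A (outcome_of x)) config_mass p s x.
Proof.
rewrite /Pr (reindex (@outcome_of m n)) /=.
  by apply: eq_bigr => x _; exact: mass_outcome_of.
exact/onW_bij/outcome_of_bij.
Qed.

Lemma twist_subproof {m n} {k : 'I_m} (k0 : (0 < k)%N) (t : 'S_n)
    (a : alignment m n) :
  [forall l : 'I_m, (val l == 0%N) ==>
    ([ffun l => if l == k then (t * val a l)%g else val a l] l == 1%g)].
Proof.
apply/forallP => l; apply/implyP => /eqP l0; rewrite ffunE.
case: (eqVneq l k) => [lk|_]; first by rewrite -lk l0 in k0.
by move: (valP a) => /forallP/(_ l); rewrite l0 eqxx.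
Qed.

(** Composition in the permutation group is read from left to right: [t * u] is
    [u] after [t]. *)
Definition twist {m n} {k : 'I_m} (k0 : (0 < k)%N) (t : 'S_n)
    (a : alignment m n) : alignment m n :=
  exist _ [ffun l => if l == k then (t * val a l)%g else val a l]
    (twist_subproof k0 t a).

(** * Swapping two vertices in one graph *)

Definition swap {m n} {k : 'I_m} (k0 : (0 < k)%N) (i j : 'I_n)
    (x : config m n) : config m n :=
  (twist k0 (tperm i j) x.1,
   [ffun e => exchange k (x.2 e) (x.2 (edge_act (tperm i j) e))]).

Lemma edge_actM {n} (t u : 'S_n) (e : edge n) :
  edge_act (t * u)%g e = edge_act u (edge_act t e).
Proof.
apply: val_inj => /=; rewrite -imset_comp.
by apply: eq_imset => x /=; rewrite permM.
Qed.

Lemma edge_act_tpermK {n} (i j : 'I_n) :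
  involutive (edge_act (tperm i j) : edge n -> edge n).
Proof.
move=> e; rewrite -edge_actM tperm2; apply: val_inj => /=.
by rewrite -[RHS]imset_id; apply: eq_imset => x; rewrite perm1.
Qed.

Lemma swapK {m n} {k : 'I_m} (k0 : (0 < k)%N) (i j : 'I_n) :
  involutive (swap k0 i j).
Proof.
move=> [a c]; congr pair.
  apply: val_inj => /=; apply/ffunP => l; rewrite !ffunE.
  by case: eqP => // _; rewrite mulgA tperm2 mul1g.
by apply/ffunP => e; rewrite !ffunE edge_act_tpermK exchangeK.
Qed.

(** The exchange redistributes mass inside each pair {e, (i j)e}, whereas the
    total mass is a product over e.  Squaring it and reindexing one factor by
    (i j) turns it into a product over pairs, to which [exchange_mass] applies;
    nonnegativity allows to take the square root back. *)
Lemma swap_mass {R : realType} {m n} (p s : R) {k : 'I_m} (k0 : (0 < k)%N)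
    (i j : 'I_n) (x : config m n) :
  0 <= p <= 1 -> 0 <= s <= 1 ->
  config_mass p s (swap k0 i j x) = config_mass p s x.
Proof.
move=> p01 s01; rewrite /config_mass; congr (_ * _).
have mass_ge0 (y : config m n) : 0 <= \prod_e column_mass p s (y.2 e).
  by apply: prodr_ge0 => e _; exact: column_mass_ge0.
apply/eqP; rewrite -(@eqrXn2 _ 2)//; apply/eqP.
have square (y : config m n) : (\prod_e column_mass p s (y.2 e)) ^+ 2 =
    \prod_e (column_mass p s (y.2 e) *
             column_mass p s (y.2 (edge_act (tperm i j) e))).
  rewrite [RHS]big_split expr2 /=; congr (_ * _).
  by rewrite (reindex_inj (inv_inj (edge_act_tpermK i j))).
rewrite !square; apply: eq_bigr => e _; rewrite !ffunE edge_act_tpermK.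
exact: exchange_mass.
Qed.

Definition meets {n} (i j : 'I_n) (e : edge n) : bool :=
  (i \in val e) || (j \in val e).

Lemma edge_act_tperm_id {n} (i j : 'I_n) (e : edge n) :
  ~~ meets i j e -> edge_act (tperm i j) e = e.
Proof.
rewrite negb_or => /andP[ie je]; apply: val_inj => /=.
rewrite -[RHS]imset_id; apply: eq_in_imset => x xe /=.
by rewrite tpermD//; apply: contraTneq xe => <-.
Qed.

Lemma meets_tperm {n} (i j : 'I_n) (e : edge n) :
  meets i j (edge_act (tperm i j) e) = meets i j e.
Proof.
apply/idP/idP; last first.
  by apply: contraTT => h; rewrite -(edge_act_tpermK i j e) edge_act_tperm_id.
by apply: contraTT => h; rewrite edge_act_tperm_id.
Qed.

(** The vertices are taken in the labelling of the parent graph. *)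
Definition isolated {m n} (k : 'I_m) (i j : 'I_n) (x : config m n) : bool :=
  [forall e, meets i j e ==> unshared k (x.2 e)].

Lemma obs_outcome_of {m n} (x : config m n) (k : 'I_m) :
  obs (outcome_of x) k =
  adj_of_edges (fun e => seen k (x.2 (edge_act (val x.1 k)^-1%g e))).
Proof.
rewrite /obs ffunE; apply: val_inj => /=; apply/matrixP => a b; rewrite !mxE.
by case: insub => // e; rewrite /parent /sampling /star /= !ffunE.
Qed.

(** In graph [k], the new permutation reads the edge (i j)e where the old one
    read e, and the exchange has moved there precisely what graph [k] saw at e.
    In the other graphs the same edge is read, and nothing seen has changed. *)
Lemma obs_swap {m n} {k : 'I_m} (k0 : (0 < k)%N) (i j : 'I_n)
    (x : config m n) : isolated k i j x ->
  obs (outcome_of (swap k0 i j x)) = obs (outcome_of x).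
Proof.
move=> /forallP iso; apply/ffunP => l; rewrite !obs_outcome_of.
apply: val_inj => /=; apply/matrixP => a b; rewrite !mxE.
case: insub => // e; rewrite !ffunE; case: (eqVneq l k) => [->|lk].
  by rewrite invMg tpermV edge_actM edge_act_tpermK seen_exchange.
set e0 := edge_act _ e; have [e0m|e0m] := boolP (meets i j e0).
  apply: seen_exchange_other => //; first exact: (implyP (iso _)).
  by apply: (implyP (iso _)); rewrite meets_tperm.
by rewrite edge_act_tperm_id// exchange_id.
Qed.

Definition wrong_at {m n} (pihat : estimator m n) (k : 'I_m) (i : 'I_n)
    (w : outcome m n) : bool :=
  val (star w) k i != val (pihat (obs w)) k i.

(** The estimate is the same before and after the swap, but the true image of
    [i] changes from pi_k(i) to pi_k(j). *)
Lemma wrong_at_swap {m n} (pihat : estimator m n) {k : 'I_m} (k0 : (0 < k)%N)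
    (i j : 'I_n) (x : config m n) : i != j -> isolated k i j x ->
  wrong_at pihat k i (outcome_of x) ||
  wrong_at pihat k i (outcome_of (swap k0 i j x)).
Proof.
move=> ij iso; rewrite /wrong_at obs_swap// /star /=.
rewrite ffunE eqxx permM tpermL.
have [<-|//] := eqVneq; rewrite /=.
by rewrite (inj_eq perm_inj) eq_sym.
Qed.

(** The swap preserves the mass, so the error events before and after it have
    the same probability, and together they cover the isolation event. *)
Lemma isolated_mass_le {R : realType} {m n} (p s : R)
    (pihat : estimator m n) {k : 'I_m} (k0 : (0 < k)%N) (i j : 'I_n) :
  0 <= p <= 1 -> 0 <= s <= 1 -> i != j ->
  \sum_(x : config m n | isolated k i j x) config_mass p s x <=
  2 * Pr p s (wrong_at pihat k i).
Proof.
move=> p01 s01 ij.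
have ge0 (x : config m n) : 0 <= config_mass p s x by exact: config_mass_ge0.
rewrite mulr_natl mulr2n [X in _ + X]Pr_config.
rewrite [X in _ + X](reindex_inj (inv_inj (swapK k0 i j))) Pr_config.
rewrite big_mkcond [X in X + _]big_mkcond [X in _ + X]big_mkcond.
rewrite -big_split; apply: ler_sum => x _ /=; rewrite swap_mass//.
case: ifPn => [iso|_]; last by apply: addr_ge0; case: ifP.
have := wrong_at_swap pihat k0 i j x ij iso.
by case: ifP => [_ _|_ /= ->]; [rewrite lerDl; case: ifP | rewrite add0r].
Qed.

(** * How likely isolated vertices are *)

(** Each such edge is {i, b} or {j, b} for some vertex b. *)
Lemma card_meets {n} (i j : 'I_n) :
  (#|[set e : edge n | meets i j e]%SET| <= n * 2)%N.
Proof.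
pose T := ('I_n * bool)%type.
pose f (x : T) : {set 'I_n} := [set (if x.2 then i else j); x.1]%SET.
apply: (@leq_trans #|f @: [set: T]%SET|); last first.
  rewrite (leq_trans (leq_imset_card _ _))//.
  by rewrite cardsT card_prod card_ord card_bool.
rewrite -(card_imset _ val_inj); apply: subset_leq_card.
apply/fintype.subsetP => _ /imsetP[e eij ->]; rewrite finset.inE in eij.
have edgeE a : a \in val e -> exists b, val e = [set a; b]%SET.
  move=> ae; have /cards2P[b [c [bc ebc]]] := valP e.
  move: ae; rewrite ebc !finset.inE => /orP[/eqP->|/eqP->]; first by exists c.
  by exists b; rewrite finset.setUC.
case/orP: eij => /edgeE[b ->]; apply/imsetP.
  by exists (b, true).
by exists (b, false).
Qed.

(** Isolation is a conjunction of independent conditions, one for each edge at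
    [i] or [j]: its mass factors over the edges. *)
Lemma isolated_mass_ge {R : realType} {m n} (p s : R) (k : 'I_m)
    (i j : 'I_n) :
  0 <= p <= 1 -> 0 <= s <= 1 -> m%:R * (p * s ^+ 2) <= 1 ->
  (1 - m%:R * (p * s ^+ 2)) ^+ (n * 2) <=
  \sum_(x : config m n | isolated k i j x) config_mass p s x.
Proof.
move=> p01 s01; set q := m%:R * _ => q1.
have q0 : 0 <= q.
  by case/andP: p01 => *; rewrite /q mulr_ge0// mulr_ge0 ?sqr_ge0.
pose F (e : edge n) (x : column m) : R :=
  if meets i j e ==> unshared k x then column_mass p s x else 0.
have al0 : (0 < #|{: alignment m n}|)%N.
  suff h : [forall k : 'I_m, (val k == 0%N) ==>
      ([ffun=> 1%g] k == 1%g :> 'S_n)].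
    by apply/card_gt0P; exists (exist _ [ffun=> 1%g] h).
  by apply/forallP => l; rewrite ffunE eqxx implybT.
have -> : \sum_(x : config m n | isolated k i j x) config_mass p s x =
    \sum_(c : {ffun edge n -> column m}) \prod_e F e (c e).
  rewrite big_mkcond -(pair_bigA _ (fun a c => if isolated k i j (a, c) then
    config_mass p s (a, c) else 0)) /=.
  rewrite (eq_bigr (fun=> #|{: alignment m n}|%:R^-1 *
    \sum_(c : {ffun edge n -> column m}) \prod_e F e (c e))) => [|a _].
    by rewrite sumr_const -[LHS]mulr_natl mulrA mulfV ?mul1r// pnatr_eq0 -lt0n.
  rewrite mulr_sumr; apply: eq_bigr => c _; case: ifPn.
    move=> /forallP iso; congr (_ * _); apply: eq_bigr => e _.
    by rewrite /F iso.
  by case/forallPn => e /negbTE he; rewrite (bigD1 e)//= /F he mul0r mulr0.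
rewrite -bigA_distr_bigA.
apply: (@le_trans _ _ (\prod_(e : edge n) (if meets i j e then 1 - q else 1))).
  rewrite -big_mkcond /= prodr_const.
  apply: ler_wiXn2l; rewrite ?subr_ge0// ?lerBlDr ?lerDl//.
  by rewrite -cardsE card_meets.
apply: ler_prod => e _; rewrite /F; case: ifP => _ /=.
  by rewrite subr_ge0 q1 -big_mkcond; exact: unshared_mass_ge.
by rewrite ler01 sum_column_mass lexx.
Qed.

(** From 1 / (1 - q) <= 1 + 2q <= exp(2q), the first inequality being where
    q <= 1/2 is used. *)
Lemma expR_le_pow {R : realType} (q K : R) (n : nat) :
  0 <= q <= 2^-1 -> n%:R * q <= K -> expR (- (4 * K)) <= (1 - q) ^+ (n * 2).
Proof.
move=> /andP[q0 q2] nq.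
apply: (@le_trans _ _ (expR (- (2 * q)) ^+ (n * 2))); last first.
  apply: lerXn2r; rewrite ?nnegrE ?expR_ge0//; first lra.
  rewrite expRN -[leRHS]invrK lef_pV2 ?posrE ?expR_gt0 ?invr_gt0; [|lra..].
  apply: le_trans (expR_ge1Dx (2 * q)).
  rewrite -[leLHS]mul1r ler_pdivrMr; last lra.
  nra.
rewrite -expRM_natl ler_expR natrM; lra.
Qed.

(** * From vertices to the overlap *)

(** The overlap counts vertices that are correct in all the graphs, which is
    harder than being correct in graph [k]. *)
Lemma wrong_count_le {R : realType} {m n} (pihat : estimator m n) (k : 'I_m)
    (w : outcome m n) : (0 < k)%N -> (0 < n)%N ->
  \sum_(i < n) (wrong_at pihat k i w)%:R <=
  n%:R * (1 - ov R (star w) (pihat (obs w))).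
Proof.
move=> k0 n0; have nR : n%:R != 0 :> R by rewrite pnatr_eq0 -lt0n.
rewrite /ov mulrBr mulr1 [n%:R * _]mulrC divfK// lerBrDr.
rewrite -natr_sum -natrD ler_nat.
rewrite -[leqRHS]card_ord -(cardsC [set i : 'I_n | wrong_at pihat k i w]%SET).
rewrite leq_add//.
  by rewrite -sum1dep_card [leqRHS]big_mkcond; apply: leq_sum => i _; case: ifP.
apply/subset_leq_card/fintype.subsetP => i; rewrite !finset.inE /wrong_at negbK.
by move=> /forallP/(_ k); rewrite k0.
Qed.

(** The fraction of misplaced vertices is at most [eps] when the overlap is at
    least 1 - eps, and at most 1 otherwise. *)
Lemma expected_wrong_le {R : realType} {m n} (p s eps : R)
    (pihat : estimator m n) (k : 'I_m) :
  0 <= p <= 1 -> 0 <= s <= 1 -> 0 < eps -> (0 < k)%N -> (0 < n)%N ->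
  \sum_(i < n) Pr p s (wrong_at pihat k i) <=
  n%:R * (eps + 1 -
    Pr p s (fun w => 1 - eps <= ov R (star w) (pihat (obs w)))).
Proof.
move=> p01 s01 eps0 k0 n0; set A : pred (outcome m n) := fun w => 1 - eps <= _.
under eq_bigr do rewrite /Pr big_mkcond.
rewrite exchange_big /= -[X in eps + X](Pr_setT m n p s) /Pr.
rewrite -[eps]mulr1 -[X in eps * X](Pr_setT m n p s) /Pr.
rewrite [X in _ - X]big_mkcond mulr_sumr -big_split -sumrB mulr_sumr.
apply: ler_sum => w _ /=.
have mw : 0 <= mass p s w by exact: mass_ge0.
have -> : \sum_(i < n) (if wrong_at pihat k i w then mass p s w else 0) =
    mass p s w * \sum_(i < n) (wrong_at pihat k i w)%:R.
  rewrite mulr_sumr; apply: eq_bigr => i _.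
  by case: ifP; rewrite ?mulr1 ?mulr0.
have [Aw|_] := ifP.
  rewrite addrK mulrA mulrC ler_wpM2r//.
  apply: le_trans (wrong_count_le pihat k w k0 n0) _.
  by rewrite ler_wpM2l// lerBlDr addrC -lerBlDr; exact: Aw.
rewrite subr0 mulrDr; apply: ler_wpDl.
  by rewrite mulr_ge0// mulr_ge0// ltW.
rewrite mulrC ler_wpM2r//.
have <- : \sum_(i < n) 1 = n%:R :> R by rewrite sumr_const card_ord.
by apply: ler_sum => i _; case: wrong_at; rewrite ?ler01.
Qed.

Theorem corollary6p3 (R : realType) (m : nat) (hm : (2 <= m)%N)
    (p s : nat -> R)
    (hp : forall n, 0 <= p n <= 1)
    (hs : forall n, 0 <= s n <= 1)
    (hO : (fun n => n%:R * p n * s n ^+ 2) =O_\oo (fun _ : nat => 1 : R)) :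
  ~ exists pihat : forall n, estimator m n, almost_exact p s pihat.
Proof.
move=> [pihat exact_pihat].
have [C C0 hC] := (@eqO_exP _ _ _ _ _ _ _).1 hO.
pose K : R := m%:R * C; pose c : R := expR (- (4 * K)).
have c0 : 0 < c by exact: expR_gt0.
(* With tolerance c/4 the error rate would be below c/4 + c/4, short of c/2. *)
have c4 : 0 < c / 4 by lra.
have /cvgrPdist_lt/(_ _ c4) cvg1 := exact_pihat _ c4.
(* A contradiction at a single large n is enough. *)
suff : \forall n \near \oo, False by case=> N _ /(_ N (leqnn N)).
near=> n.
have n1 : (1 < n)%N by near: n; exists 2%N.
have n2K : 2 * K <= n%:R by near: n; exact: nbhs_infty_ger.
have nR : 0 < n%:R :> R by rewrite ltr0n ltnW.
pose q : R := m%:R * (p n * s n ^+ 2).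
have q0 : 0 <= q.
  by have /andP[? _] := hp n; rewrite mulr_ge0// mulr_ge0 ?sqr_ge0.
(* The hypothesis n p s^2 = O(1) enters here. *)
have nq : n%:R * q <= K.
  rewrite /q mulrCA /K ler_wpM2l// mulrA.
  have : `|n%:R * p n * s n ^+ 2| <= C * `|1 : R| by near: n.
  by rewrite normr1 mulr1; apply: le_trans; exact: ler_norm.
have q2 : q <= 2^-1 by rewrite -(ler_pM2l nR); lra.
pose k : 'I_m := Ordinal hm.
have wrong_ge (i : 'I_n) : c / 2 <= Pr (p n) (s n) (wrong_at (pihat n) k i).
  have [j ij] : exists j : 'I_n, i != j.
    have [->|] := eqVneq i (Ordinal n1); last by exists (Ordinal n1).
    by exists (Ordinal (ltnW n1)).
  rewrite ler_pdivrMr// mulrC.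
  apply: le_trans (isolated_mass_le _ _ (pihat n) _ i j (hp n) (hs n) ij) => //.
  apply: le_trans (isolated_mass_ge _ _ k i j (hp n) (hs n) _); last first.
    by rewrite -/q; lra.
  by apply: expR_le_pow => //; rewrite q0.
have : n%:R * (c / 2) <= n%:R * (c / 4 + 1 -
    Pr (p n) (s n) (fun w => 1 - c / 4 <= ov R (star w) (pihat n (obs w)))).
  apply: le_trans
    (expected_wrong_le _ _ _ (pihat n) k (hp n) (hs n) c4 _ _) => //.
    by rewrite -{1}(card_ord n) mulr_natl -sumr_const; exact: ler_sum.
  exact: ltnW.
rewrite ler_pM2l//.
have : `|1 - Pr (p n) (s n)
    (fun w => 1 - c / 4 <= ov R (star w) (pihat n (obs w)))| < c / 4 by near: n.
rewrite ltr_norml; lra.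
Unshelve. all: by end_near.
Qed.
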